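(* Let $\ell$ be an arbitrary integer with $\ell \geq 8$. Given two vertices $w_{0}, w_{\ell+1}$ (not necessarily distinct) of the odd graph $O_{3}$ and elements $\lambda_{1}, \lambda_{2} \in \{1, 2, 3, 4, 5\}$ with $\lambda_{1} \notin [w_{0}]$ and $\lambda_{2} \notin [w_{\ell+1}]$, there exists an $(\ell+1)$-special walk from $w_{0}$ to $w_{\ell+1}$ such that its first edge is labeled with $\lambda_{1}$ and its last edge is labeled with $\lambda_{2}$.
   Context: The odd graph $O_{n}$ has one vertex for each $(n-1)$-element subset of $\{1, 2, \dots, 2n-1\}$, and two vertices are adjacent if and only if the corresponding subsets are disjoint. For a vertex $v$ of $O_n$, $[v]$ denotes the corresponding subset. Each edge $uv$ is labeled with the unique element of $\{1, \dots, 2n-1\}$ contained in neither $[u]$ nor $[v]$. A walk of length $k$ from $v_0$ to $v_k$ is a sequence of vertices $v_0 v_1 \dots v_k$ with consecutive vertices adjacent (vertices and edges may repeat); its edges are $v_0v_1, v_1v_2, \dots, v_{k-1}v_k$. A special walk is a walk in which every two consecutive edges are distinct. A $k$-special walk is a special walk of length $k$. *)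

(* Defs.v *)
From HB Require Import structures.
From mathcomp Require Import all_boot.

Set Implicit Arguments.
Unset Strict Implicit.
Unset Printing Implicit Defensive.

(* The ground set {1, ..., 2n-1}, indexed from 0. *)
Notation odd_ground n := 'I_(2 * n - 1).

Record odd_vertex (n : nat) := OddVertex {
  odd_set : {set odd_ground n};
  _ : #|odd_set| == n - 1
}.

HB.instance Definition _ (n : nat) := [isSub for @odd_set n].
HB.instance Definition _ (n : nat) := [Finite of odd_vertex n by <:].

(* For n = 1 the single vertex carries the empty set, hence a loop; for n >= 2
   the relation is irreflexive. *)
Definition odd_adj (n : nat) : rel (odd_vertex n) :=
  fun u v => [disjoint odd_set u & odd_set v].

(* An edge uv is the set [set u; v]; [odd_label e x] says that x is the unique
   element lying in no endpoint of e. *)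
Definition odd_label (n : nat) (e : {set odd_vertex n}) (x : odd_ground n) :=
  [set y | [forall u in e, y \notin odd_set u]] == [set x].

(* The walk v_0 v_1 ... v_k is given by v_0 and the sequence [:: v_1; ...; v_k];
   its length is therefore the size of that sequence. *)
Definition walk_edges (T : finType) (v0 : T) (p : seq T) : seq {set T} :=
  pairmap (fun u v => [set u; v]) v0 p.

Definition special_walk (T : finType) (e : rel T) (v0 : T) (p : seq T) :=
  path e v0 p && sorted (fun a b => a != b) (walk_edges v0 p).

(* Main.v *)
Require Import Defs.
From mathcomp Require Import all_boot.

Set Implicit Arguments.
Unset Strict Implicit.
Unset Printing Implicit Defensive.

(** Write an oriented edge from u to v of O_3 as a list a b x c d of the five
    ground elements, where {a, b} = [u], {c, d} = [v] and x is the label.  The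
    list is determined up to exchanging a and b and exchanging c and d.  A
    special walk that has just traversed this edge must leave v by an edge
    whose label is not in [v] and differs from x, so the next label is a or b;
    if it is a, then the next vertex is {b, x} and the new list is c d a b x.
    Thus each step of a special walk is an optional exchange of the first two
    entries followed by a cyclic rotation by two places ([turn]), and
    conversely every word of such choices gives a special walk
    ([special_walk_of_turns]).

    Undoing the rotations, the successive steps offer optional exchanges of two
    cyclically adjacent places, starting at place 0, 3, 1, 4, 2, 0, 3, 1 and so
    on.  Eight steps make eight offers, and the freedom to order the two pairs
    of the final list accounts for the next two offers.  These ten optional
    exchanges produce all 120 arrangements of five elements ([reach8]), so that
    eight steps lead from any oriented edge to any other.  Turns commute with
    renaming the elements, so the starting arrangement may be taken to be
    0 1 2 3 4, and the claim is then a finite computation.  A walk with more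
    steps spends the first ones arbitrarily ([connect_turns]). *)

(** * Turns of lists *)

Definition swap_first2 (T : Type) (s : seq T) : seq T :=
  if s is a :: b :: s' then b :: a :: s' else s.

Definition turn (T : Type) (s : seq T) (b : bool) : seq T :=
  rotr 2 (if b then swap_first2 s else s).

Lemma map_turns (T1 T2 : Type) (f : T1 -> T2) (m : bitseq) (s : seq T1) :
  foldl (@turn T2) (map f s) m = map f (foldl (@turn T1) s m).
Proof.
elim: m s => //= b m IHm s; rewrite -IHm /turn map_rotr.
by case: b s => [] [|a [|c s]].
Qed.

Lemma perm_turns (T : eqType) (m : bitseq) (s : seq T) :
  perm_eq (foldl (@turn T) s m) s.
Proof.
elim: m s => //= b m IHm s; apply: perm_trans (IHm _) _.
rewrite /turn perm_rotr; case: b s => [] [|a [|c s]] //=.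
by rewrite -[a :: c :: s]/([:: a; c] ++ s) -[c :: a :: s]/([:: c; a] ++ s)
           perm_cat2r (perm_catC [:: c] [:: a]).
Qed.

(** Searching the words by recursion on their length keeps the test for
    [reach8] executable. *)
Fixpoint reach (T : Type) (P : pred (seq T)) (n : nat) (s : seq T) : bool :=
  if n is n'.+1 then reach P n' (turn s false) || reach P n' (turn s true)
  else P s.

Lemma reach_turns (T : Type) (P : pred (seq T)) n s :
  reach P n s -> exists2 m, size m = n & P (foldl (@turn T) s m).
Proof.
elim: n s => [|n IHn] s /=; first by exists [::].
by case/orP=> /IHn[m <- Pm]; [exists (false :: m) | exists (true :: m)].
Qed.

(** Agreement of the middle entry and of the last pair: for two arrangements of
    the same five elements this says that they spell the same oriented edge. *)
Definition same_arc (T : eqType) (x0 : T) (s t : seq T) : bool :=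
  (nth x0 s 2 == nth x0 t 2) && perm_eq (drop 3 s) (drop 3 t).

Lemma reach8 :
  all (fun t => reach (same_arc 0 ^~ t) 8 (iota 0 5)) (permutations (iota 0 5)).
Proof. by vm_compute. Qed.

(** The first l - 8 turns only replace s by another arrangement of its entries.
    The positions in that arrangement of the entries of t form a permutation
    of 0 1 2 3 4, and [reach8] applies to it. *)
Lemma connect_turns (T : eqType) (x0 : T) (s t : seq T) (l : nat) :
    8 <= l -> size s = 5 -> perm_eq t s ->
  exists2 m, size m = l & same_arc x0 (foldl (@turn T) s m) t.
Proof.
move=> l_ge8 size_s ts; pose m0 := nseq (l - 8) false.
pose s0 := foldl (@turn T) s m0.
have s0s : perm_eq s0 s by apply: perm_turns.
have size_s0 : size s0 = 5 by rewrite (perm_size s0s).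
have /(perm_iotaP x0)[r perm_r def_t] : perm_eq t s0.
  by rewrite (perm_trans ts) // perm_sym.
rewrite size_s0 in perm_r.
have size_r : size r = 5 by rewrite (perm_size perm_r).
have := allP reach8 r; rewrite mem_permutations => /(_ perm_r).
case/reach_turns=> m size_m /andP[/eqP mid_r last_r].
exists (m0 ++ m); first by rewrite size_cat size_m size_nseq subnK.
have def_s0 : s0 = [seq nth x0 s0 i | i <- iota 0 5].
  by rewrite -size_s0 map_nth_iota0 // take_size.
rewrite foldl_cat -/s0 def_s0 map_turns def_t /same_arc.
have size_m5 : size (foldl (@turn nat) (iota 0 5) m) = 5.
  by rewrite (perm_size (perm_turns _ _)).
rewrite !(nth_map 0) ?size_m5 ?size_r // mid_r eqxx /=.
by rewrite -!map_drop perm_map.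
Qed.

(** * Oriented edges of O_3 as arrangements of the five elements *)

Definition spells (s : seq (odd_ground 3)) (u v : odd_vertex 3) : Prop :=
  [/\ uniq s, size s = 5, odd_set u = [set:: take 2 s]
    & odd_set v = [set:: drop 3 s]].

Lemma spells_all s u v : spells s u v -> s =i predT.
Proof.
case=> s_uniq size_s _ _; apply/subset_cardP; last exact/subset_predT.
by rewrite (card_uniqP s_uniq) size_s card_ord.
Qed.

Lemma spells_perm s t u v u' v' :
  spells s u v -> spells t u' v' -> perm_eq t s.
Proof.
move=> hs ht; have [s_uniq _ _ _] := hs; have [t_uniq _ _ _] := ht.
by apply: uniq_perm => // x; rewrite (spells_all hs) (spells_all ht).
Qed.

(** Reversal turns a prescribed label at the last vertex into a prescribed label
    at a first vertex, so [spells_exists] serves both ends of the walk. *)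
Lemma spells_rev s u v : spells s u v -> spells (rev s) v u.
Proof.
case=> s_uniq size_s u_s v_s; split; rewrite ?rev_uniq ?size_rev //.
  by rewrite v_s take_rev size_s; apply/setP=> x; rewrite !inE mem_rev.
by rewrite u_s drop_rev size_s; apply/setP=> x; rewrite !inE mem_rev.
Qed.

Lemma odd_set_vertex (A : {set odd_ground 3}) :
  #|A| = 2 -> exists v : odd_vertex 3, odd_set v = A.
Proof. by move/eqP=> cardA; exists (OddVertex cardA). Qed.

Lemma spells_exists (u : odd_vertex 3) (x : odd_ground 3) :
    x \notin odd_set u ->
  exists s v, spells s u v /\ nth x s 2 = x.
Proof.
move=> xNu; have card_u : #|odd_set u| == 2 by case: (u).
have card_v : #|~: (x |: odd_set u)| = 2.
  by rewrite cardsCs setCK cardsU1 xNu (eqP card_u) card_ord.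
have [v v_set] := odd_set_vertex card_v.
have /cards2P[a [b [ab u_set]]] := card_u.
have /eqP/cards2P[c [d [cd v_cd]]] := card_v.
exists [:: a; b; x; c; d], v; split=> //; split=> //=; last first.
- by rewrite v_set v_cd; apply/setP=> y; rewrite !inE.
- by rewrite u_set; apply/setP=> y; rewrite !inE.
have: c \in ~: (x |: odd_set u) by rewrite v_cd !inE eqxx.
have: d \in ~: (x |: odd_set u) by rewrite v_cd !inE eqxx orbT.
move: xNu; rewrite u_set !inE !negb_or ab cd.
by rewrite ![_ == c]eq_sym ![_ == d]eq_sym ![_ == x]eq_sym
  => /andP[-> ->] /and3P[-> -> ->] /and3P[-> -> ->].
Qed.

Lemma spells_adj s u v : spells s u v -> odd_adj u v.
Proof.
case=> s_uniq size_s u_s v_s; rewrite /odd_adj u_s v_s disjoint_subset.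
apply/subsetP=> x; rewrite !inE => x_take; apply: contraL s_uniq => x_drop.
rewrite -(cat_take_drop 2 s) cat_uniq negb_and negb_and; apply/orP; right.
apply/orP; left; rewrite negbK; apply/hasP; exists x => //.
by move: x_drop; rewrite -[3]/(1 + 2) -drop_drop; apply: mem_drop.
Qed.

Lemma spells_label s u v x0 : spells s u v -> odd_label [set u; v] (nth x0 s 2).
Proof.
move=> sp; have s_all := spells_all sp.
case: sp; case: s s_all => [|a [|b [|x [|c [|d [|]]]]]] //=.
move=> s_all s_uniq _ u_s v_s; apply/eqP/setP=> y; rewrite !inE.
have -> : [forall w in [set u; v], y \notin odd_set w]
          = (y \notin [:: a; b]) && (y \notin [:: c; d]).
  apply/forall_inP/andP=> [yN | [yNu yNv] w].
    have := yN u; have := yN v; rewrite !inE !eqxx ?orbT u_s v_s !inE.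
    by move=> -> // ->.
  by case/set2P=> ->; rewrite ?u_s ?v_s in_set.
apply/andP/eqP=> [[yNab yNcd] | ->].
  move: (s_all y) yNab yNcd; rewrite !inE.
  by case/or4P=> [/eqP-> | /eqP-> | /eqP-> // | ->]; rewrite ?eqxx ?orbT.
move: s_uniq; rewrite /= !inE !negb_or -!andbA ![x == _]eq_sym.
by case/and5P=> _ -> _ _ /and5P[-> _ _ ]; rewrite ![_ == x]eq_sym => -> /andP[->].
Qed.

(** The first entry after the optional exchange becomes the new label; it lies
    in the set of u and not in that of w, so that the walk does not turn back. *)
Lemma spells_turn s u v b :
  spells s u v -> exists2 w, spells (turn s b) v w & u != w.
Proof.
(* Exchanging the first two entries leaves the spelled edge unchanged. *)
wlog -> : s b / b = false => [IH | sp].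
  case: b => sp; last exact: IH.
  apply: (IH (swap_first2 s) false) => //.
  case: sp; case: s => [|a [|c s]] //= s_uniq size_s u_s v_s; split=> //=.
    by move: s_uniq; rewrite !inE !negb_or eq_sym /=; case: (_ == _) => //=;
      do 2!case: (_ \in s) => //=.
  by rewrite u_s take0; apply/setP=> y; rewrite !inE orbC.
case: sp; case: s => [|a [|c [|x [|d [|e [|]]]]]] //= s_uniq _ u_s v_s.
have cx : c != x by case/and5P: s_uniq => _; rewrite !inE negb_or => /andP[].
have [w w_set] : exists w : odd_vertex 3, odd_set w = [set c; x].
  by apply: odd_set_vertex; rewrite cards2 cx.
exists w.
  split=> //; first by rewrite /turn rotr_uniq.
  by rewrite w_set; apply/setP=> y; rewrite !inE.
apply: contraTneq s_uniq => uw.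
have: a \in odd_set w by rewrite -uw u_s !inE eqxx.
by rewrite w_set /= !inE orbA => ->.
Qed.

(** * Special walks from words of turns *)

(** The edge spelled by s is already part of the walk, so that a word of length
    n yields n + 1 edges, the last of which has index n. *)
Lemma special_walk_of_turns (m : bitseq) s u v :
    spells s u v ->
  exists p u',
    [/\ special_walk (@odd_adj 3) u (v :: p), size p = size m,
        nth set0 (walk_edges u (v :: p)) (size m) = [set u'; last v p]
      & spells (foldl (@turn _) s m) u' (last v p)].
Proof.
elim: m s u v => [|b m IHm] s u v sp.
  by exists [::], u; split=> //; rewrite /special_walk /= (spells_adj sp).
have [w sp_w uNw] := spells_turn b sp.
have [p [u' [/andP[path_p sorted_p] size_p last_edge sp_p]]] := IHm _ _ _ sp_w.
exists (w :: p), u'; split=> //=; last by rewrite size_p.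
apply/andP; split; first by rewrite /= (spells_adj sp).
rewrite /=; apply/andP; split; last exact: sorted_p.
apply/eqP=> /setP/(_ u).
have uNv : u != v.
  apply: contraTneq (spells_adj sp) => <-; rewrite /odd_adj -setI_eq0 setIid.
  by rewrite -cards_eq0; case: (u) => A /= /eqP->.
by rewrite !inE eqxx (negPf uNv) (negPf uNw).
Qed.

Theorem theorem2p4 (l : nat) (l_ge8 : 8 <= l) (w_first w_last : odd_vertex 3)
    (lambda1 lambda2 : odd_ground 3)
    (lambda1_notin : lambda1 \notin odd_set w_first)
    (lambda2_notin : lambda2 \notin odd_set w_last) :
  exists p : seq (odd_vertex 3),
    [/\ special_walk (@odd_adj 3) w_first p,
        size p = l + 1,
        last w_first p = w_last,
        odd_label (nth set0 (walk_edges w_first p) 0) lambda1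
      & odd_label (nth set0 (walk_edges w_first p) l) lambda2].
Proof.
have [s [v [sp_s mid_s]]] := spells_exists lambda1_notin.
have [r [u [sp_r mid_r]]] := spells_exists lambda2_notin.
have [r_uniq size_r _ w_last_r] := spells_rev sp_r.
have [_ size_s _ _] := sp_s.
have [m size_m /andP[/eqP mid_m last_m]] :=
  connect_turns lambda2 l_ge8 size_s (spells_perm sp_s (spells_rev sp_r)).
have [p [u' [walk_p size_p last_edge sp_p]]] := special_walk_of_turns m sp_s.
exists (v :: p); split=> //.
- by rewrite /= size_p size_m addn1.
- have [_ _ _ last_p] := sp_p; apply: val_inj => /=; rewrite last_p w_last_r.
  by apply/setP=> y; rewrite !inE (perm_mem last_m).
- by rewrite /= -mid_s; apply: spells_label.
rewrite -size_m last_edge; have := spells_label lambda2 sp_p.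
by rewrite mid_m nth_rev -(size_rev r) size_r // mid_r.
Qed.
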